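(* Let $2\leqslant b\in\mathbb{N}^+$, $2\leqslant n\in\mathbb{N}^+$ and let $\tau\in\mathbb{N}^+$ satisfy $1\leqslant n-1\leqslant\tau$. If $f:\mathbb{T}^n\to\mathbb{R}^n$ admits a $(\tau+1)$-th order Dini modified $L^2$-modulus of continuity, i.e. $f\in\mathcal{H}^{\tau+1}(\mathbb{T}^n)$ and $$\int_0^1\frac{\widetilde\varpi_{L^2}(D^{\tau+1}f,x)}{x}\,dx<+\infty,$$ then $f\in\widetilde{\mathcal{L}^2_{\tau+1,b}}(\mathbb{T}^n)$.
   Context: $\mathbb{T}^n:=\mathbb{R}^n/2\pi\mathbb{Z}^n$. Functions $f:\mathbb{T}^n\to\mathbb{R}^n$ have Fourier expansion $f(x)=\sum_{k\in\mathbb{Z}^n} f_k e^{\mathrm{i}\langle k,x\rangle}$, where $\langle k,x\rangle=\sum_{j=1}^n k_jx_j$ and $f_k=\int_{\mathbb{T}^n} f(x)e^{-\mathrm{i}\langle k,x\rangle}\,dx$ (the measure being normalized so that the expansion holds). $|k|:=\sum_{j=1}^n|k_j|$, and likewise $|s|:=\sum_{j=1}^n|s_j|$ for $s\in\mathbb{R}^n$. $\mathcal{H}^m(\mathbb{T}^n)$ is the usual $L^2$-based Sobolev space. Define $$\widetilde{\mathcal{L}^2_{\tau+1,b}}(\mathbb{T}^n):=\Big\{f:\ \sum_{\nu=0}^\infty\Big(\sum_{b^{\nu-1}<|k|\leqslant b^\nu}|f_k|^2|k|^{2\tau+2}\Big)^{1/2}<+\infty\Big\}.$$ For $g\in L^2(\mathbb{T}^n)$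 its $0$-th order modified $L^2$-modulus of continuity is $$\widetilde\varpi_{L^2}(g,x):=\sup_{|s|\leqslant x}\Big(\int_{\mathbb{T}^n}|g(y+s)+g(y-s)-2g(y)|^2\,dy\Big)^{1/2}.$$ For $f\in\mathcal{H}^m(\mathbb{T}^n)$, $m\in\mathbb{N}^+$, its $m$-th order modified $L^2$-modulus of continuity is $$\widetilde\varpi_{L^2}(D^mf,x):=\Big(\sum_{|\alpha|=m}\widetilde\varpi_{L^2}^2(\partial^\alpha f,x)\Big)^{1/2},$$ where $\alpha=(\alpha_1,\dots,\alpha_n)$ ranges over non-negative integer vectors with $|\alpha|=\sum_j\alpha_j=m$. A modified $L^2$-modulus is called Dini if $\int_0^1\widetilde\varpi_{L^2}(\cdot,x)\,x^{-1}dx<+\infty$. *)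

(* Defs.v *)
From HB Require Import structures.
From mathcomp Require Import all_boot all_order all_algebra.
From mathcomp Require Import all_classical all_reals all_analysis.
From mathcomp Require Import complex.

Set Implicit Arguments.
Unset Strict Implicit.
Unset Printing Implicit Defensive.
Import Order.TTheory GRing.Theory Num.Theory.
Import numFieldNormedType.Exports.

Local Open Scope classical_set_scope.
Local Open Scope complex_scope.
Local Open Scope ring_scope.

(* Matrices carry the sigma-algebra generated by the coordinate maps; for real
   matrices this is the Borel sigma-algebra. *)
Definition measure_matrix_display : measure_display -> measure_display.
Proof. exact. Qed.

Section measurable_matrix.
Context {d} {T : measurableType d} (m n : nat).

Definition matrix_cylinders : set (set 'M[T]_(m, n)) :=
  \bigcup_(ij in [set: 'I_m * 'I_n])
    preimage_set_system setT (fun A : 'M[T]_(m, n) => A ij.1 ij.2) measurable.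

Let matrix_set0 : <<s matrix_cylinders >> set0.
Proof. exact: sigma_algebra0. Qed.

Let matrix_setC A : <<s matrix_cylinders >> A -> <<s matrix_cylinders >> (~` A).
Proof. exact: sigma_algebraC. Qed.

Let matrix_bigcup (F : (set 'M[T]_(m, n))^nat) :
  (forall i, <<s matrix_cylinders >> (F i)) ->
  <<s matrix_cylinders >> (\bigcup_i F i).
Proof. exact: sigma_algebra_bigcup. Qed.

HB.instance Definition _ := @isMeasurable.Build (measure_matrix_display d)
  'M[T]_(m, n) <<s matrix_cylinders >> matrix_set0 matrix_setC matrix_bigcup.

End measurable_matrix.

Lemma measurable_coord d (T : measurableType d) m n (i : 'I_m) (j : 'I_n) :
  measurable_fun setT (fun A : 'M[T]_(m, n) => A i j).
Proof.
move=> _ Y mY; rewrite setTI; apply: sub_sigma_algebra.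
by exists (i, j) => //=; exists Y => //; rewrite setTI.
Qed.

Lemma measurable_fun_matrixP d d' (X : measurableType d) (T : measurableType d')
    m n (f : X -> 'M[T]_(m, n)) :
  measurable_fun setT f <-> forall i j, measurable_fun setT (fun x => f x i j).
Proof.
split=> [mf i j|mf].
  exact: (measurableT_comp (measurable_coord i j)).
apply: (@measurability _ _ _ _ _ _ (@matrix_cylinders _ T m n)) => //.
move=> _ [_ [[i j] _ [B mB <-]] <-] /=.
by rewrite setTI setTI -comp_preimage -[X in measurable X]setTI; exact: mf.
Qed.

Section torus_measure.
Variable R : realType.

Definition row_cons n (p : measurableTypeR R * 'rV[R]_n) : 'rV[R]_(1 + n) := row_mx p.1%:M p.2.

Lemma measurable_row_cons n : measurable_fun setT (@row_cons n).
Proof.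
apply/measurable_fun_matrixP => i j.
case: (split_ordP j) => k ->.
  rewrite (_ : (fun _ => _) = fst) //; apply/funext => p.
  by rewrite /row_cons row_mxEl !ord1 mxE eqxx.
rewrite (_ : (fun _ => _) = (fun A : 'rV[R]_n => A i k) \o snd).
  exact: (measurableT_comp (measurable_coord i k)).
by apply/funext => p; rewrite /row_cons row_mxEr.
Qed.

HB.instance Definition _ n :=
  @isMeasurableFun.Build _ _ _ _ (@row_cons n) (@measurable_row_cons n).

Lemma lt0_2pi : 0 < 2 * pi :> R.
Proof. by rewrite mulr_gt0 ?pi_gt0. Qed.

(* Functions on T^n = R^n / 2 pi Z^n are represented by 2 pi Z^n-periodic
   functions on R^n; integrals over T^n are integrals over [0, 2 pi]^n against
   the normalized measure dx / (2 pi)^n, which is the normalization making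
   f = sum_k f_k e^{i <k, x>} valid with f_k as in [fourier_coef] below. *)
Fixpoint torus_measure n : probability 'rV[R]_n R :=
  match n with
  | 0 => dirac (0 : 'rV[R]_0)
  | m.+1 => distribution (uniform_prob lt0_2pi \x torus_measure m)%E
                         (@row_cons m)
  end.

End torus_measure.

Section torus_spaces.
Context {R : realType} {n : nat}.
Local Notation mu := (torus_measure R n).
Implicit Types (f g : 'rV[R]_n -> 'rV[R]_n) (x s : 'rV[R]_n) (k : 'rV[int]_n).

Definition torus_periodic (T : Type) (h : 'rV[R]_n -> T) :=
  forall x (i : 'I_n), h (x + (2 * pi) *: 'e_i) = h x.

Definition torus_L2 : set ('rV[R]_n -> 'rV[R]_n) :=
  [set f | torus_periodic f /\
    forall j, (fun x => f x ord0 j) \in Lfun mu 2%:E].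

(* |k| and |s| are l^1-norms; values of f (in R^n) and its Fourier coefficients
   (in C^n) are measured in the Euclidean and Hermitian norms, for which
   Parseval's identity holds. *)
Definition l1normz k : nat := (\sum_j `|k ord0 j|)%N.
Definition l1norm (v : 'rV[R]_n) : R := \sum_j `|v ord0 j|.
Definition l2norm (v : 'rV[R]_n) : R := Num.sqrt (\sum_j v ord0 j ^+ 2).
Definition l2normc (v : 'rV[R[i]]_n) : R :=
  Num.sqrt (\sum_j ComplexField.Normc.normc (v ord0 j) ^+ 2).

Definition pairing k x : R := \sum_j (k ord0 j)%:~R * x ord0 j.

Definition expi (t : R) : R[i] := cos t +i* sin t.

Definition Cintegral (h : 'rV[R]_n -> R[i]) : R[i] :=
  (\int[mu]_x complex.Re (h x)) +i* (\int[mu]_x complex.Im (h x)).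

Definition fourier_coef f k : 'rV[R[i]]_n :=
  \row_j Cintegral (fun x => (f x ord0 j)%:C * expi (- pairing k x)).

(* The exponent nu - 1 is an integer: for nu = 0 and b >= 2 the annulus
   b^-1 < |k| <= 1 consists of the k with |k| = 1. *)
Definition annulus (b nu : nat) : set 'rV[int]_n :=
  [set k | (b%:R : R) ^ (nu%:Z - 1) < ((l1normz k)%:R : R) <= b%:R ^+ nu].

Definition L2tilde (tau b : nat) : set ('rV[R]_n -> 'rV[R]_n) :=
  [set f | torus_L2 f /\
    (\sum_(0 <= nu <oo)
       (\esum_(k in annulus b nu)
          (l2normc (fourier_coef f k) ^+ 2
             * (l1normz k)%:R ^+ (2 * tau + 2))%:E) `^ (2^-1)%R < +oo)%E].

Fixpoint Ck_fun (m : nat) (phi : 'rV[R]_n -> R) : Prop :=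
  continuous phi /\
  if m is m'.+1 then
    forall i : 'I_n, (forall x, derivable phi x 'e_i) /\ Ck_fun m' ('D_'e_i phi)
  else True.

Definition test_fun (phi : 'rV[R]_n -> R) :=
  torus_periodic phi /\ forall m, Ck_fun m phi.

(* For smooth phi the order in which the coordinates are treated is irrelevant. *)
Definition partial (a : 'I_n -> nat) (phi : 'rV[R]_n -> R) : 'rV[R]_n -> R :=
  foldr (fun i psi => iter (a i) (fun h => 'D_'e_i h) psi) phi (enum 'I_n).

(* g is the weak (distributional) derivative of order a of f, and lies in L^2. *)
Definition is_weak_partial (a : 'I_n -> nat) f g :=
  torus_L2 g /\
  forall phi, test_fun phi -> forall j,
    \int[mu]_x (f x ord0 j * partial a phi x) =
    (- 1) ^+ (\sum_i a i) * \int[mu]_x (g x ord0 j * phi x).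

Definition sobolev (m : nat) : set ('rV[R]_n -> 'rV[R]_n) :=
  [set f | torus_L2 f /\
    forall a : 'I_n -> nat, (\sum_i a i <= m)%N ->
      exists g, is_weak_partial a f g].

(* A representative of the weak derivative, which is unique up to equality
   almost everywhere; the junk value 0 is used if there is none. *)
Definition weak_partial (a : 'I_n -> nat) f : 'rV[R]_n -> 'rV[R]_n :=
  xget (cst 0) [set g | is_weak_partial a f g].

Definition second_diff g s : 'rV[R]_n -> 'rV[R]_n :=
  fun y => g (y + s) + g (y - s) - 2 *: g y.

Definition modulus0 g (t : R) : \bar R :=
  ereal_sup [set 'N[mu]_2%:E[EFin \o (l2norm \o second_diff g s)]%E
               | s in [set s | l1norm s <= t]].

(* A multi-index a with |a| = m has all its entries at most m. *)
Definition modulus (m : nat) f (t : R) : \bar R :=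
  ((\sum_(a : {ffun 'I_n -> 'I_m.+1} | (\sum_i a i == m)%N)
      modulus0 (weak_partial (fun i => a i) f) t ^+ 2) `^ (2^-1)%R)%E.

End torus_spaces.

Definition Dini (R : realType) (w : R -> \bar R) :=
  (\int[lebesgue_measure]_(t in `]0%R, 1%R[) (w t * (t^-1)%:E) < +oo)%E.

(* Main.v *)
Require Import Defs.
From HB Require Import structures.
From mathcomp Require Import all_boot all_order all_algebra.
From mathcomp Require Import all_classical all_reals all_analysis.
From mathcomp Require Import measurable_realfun ring lra.

(** Let [m = tau + 1] and let [A_nu] be the annulus [b^(nu-1) < |k| <= b^nu].

    A step [s] multiplies the Fourier coefficient [g_k] by [2 cos <k, s> - 2] in the
    second difference [g(y + s) + g(y - s) - 2 g(y)], and [g_k = (i k_i)^m f_k] for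
    [g] the [m]-th derivative of [f] in the direction [i]. Take [s] of length [t] in
    the same direction. If [t] is between [b^-(nu+1)] and [b^-nu] and [k_i] is the
    largest coordinate of [k] in [A_nu], then [<k, s> = k_i t] is bounded by [1] and
    bounded away from [0] uniformly in [nu], so the multiplier is bounded below by a
    positive constant ([annulus_gap]). Bessel's inequality ([bessel_modulus0]) then
    gives, with a constant [K] depending only on [n], [b] and [m],

      sum_(k in A_nu) |f_k|^2 |k|^(2 m) <= K modulus(t)^2

    for all these [t] ([annulus_sum_le_modulus]). Each such interval of [t] has mass
    at least [1 - 1/b] for [dt / t], so the sum over [nu] of the square roots of
    the left-hand sides is at most a constant times the Dini integral
    ([dini_series]).

    Fourier analysis enters only through orthogonality and the effect of
    translations, and both follow from the translation invariance of the
    measure of the torus ([ge0_integral_torus_shift]): a nontrivial character changes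
    sign under some translation, so its integral is zero. Derivatives are weak, and
    their coefficients are found by testing against [cos <k, x>] and [sin <k, x>].
    As [f] is real, all this is done with pairs of real coefficients. *)

Set Implicit Arguments.
Unset Strict Implicit.
Unset Printing Implicit Defensive.
Import Order.TTheory GRing.Theory Num.Theory.
Import numFieldNormedType.Exports.
Local Open Scope classical_set_scope.
Local Open Scope ring_scope.

(** * Translations of the line and of the circle *)

Section real_line.
Context {R : realType}.
Notation leb := (@lebesgue_measure R).

Definition shiftr (c : R) : measurableTypeR R -> measurableTypeR R := +%R^~ c.

Lemma measurable_shiftr c : measurable_fun setT (shiftr c).
Proof. exact: measurable_funD. Qed.

HB.instance Definition _ c :=
  @isMeasurableFun.Build _ _ _ _ (shiftr c) (measurable_shiftr c).

(** By uniqueness of the Lebesgue measure, it is enough to translate intervals. *)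
Lemma lebesgue_measure_shift c (A : set R) : measurable A ->
  pushforward leb (shiftr c) A = leb A.
Proof.
move=> mA; apply/esym.
apply: (lebesgue_measure_unique (mu := pushforward leb (shiftr c))) => //.
move=> _ [[a b] _ <-] /=; rewrite /pushforward.
have -> : shiftr c @^-1` `]a, b] = `]a - c, b - c]%classic.
  by apply/seteqP; split=> x /=; rewrite !in_itv/= ltrBlDr lerBrDr.
rewrite !lebesgue_measure_itv /= !lte_fin ltrD2r.
by case: ifP => // _; rewrite -!EFinB; congr (_%:E); ring.
Qed.

Lemma ge0_integral_shift (f : measurableTypeR R -> \bar R) c D : measurable D ->
  measurable_fun setT f -> (forall x, 0 <= f x)%E ->
  (\int[leb]_(x in shiftr c @^-1` D) f (shiftr c x) = \int[leb]_(x in D) f x)%E.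
Proof.
move=> mD mf f0.
rewrite -(@ge0_integral_pushforward _ _ _ _ _ (shiftr c) (measurable_shiftr c)
  leb)//; last first.
  exact: measurable_funTS.
by apply: eq_measure_integral => A mA _; exact: lebesgue_measure_shift.
Qed.


Lemma periodicz (T : Type) (f : R -> T) P : (forall x, f (x + P) = f x) ->
  forall (m : int) x, f (x + m%:~R * P) = f x.
Proof.
move=> fP m x; have fPn (n : nat) y : f (y + n%:R * P) = f y.
  elim: n y => [|n IHn] y; first by rewrite mul0r addr0.
  by rewrite -addn1 natrD mulrDl mul1r addrA fP.
case: m => n; first exact: fPn.
by rewrite NegzE mulrNz mulNr -[LHS](fPn n.+1) addrNK.
Qed.

Lemma preimage_shiftr_co (a b c : R) :
  shiftr c @^-1` `[a + c, b + c[ = `[a, b[%classic.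
Proof. by apply/seteqP; split=> x /=; rewrite !in_itv/= lerD2r ltrD2r. Qed.

(** Shifting the window from [0] to [2 pi] by [c] cuts off the part from [0] to [c]
    and adds the part from [2 pi] to [2 pi + c], where a periodic function takes the
    same values. *)
Lemma ge0_integral_uniform_shift (f : measurableTypeR R -> \bar R) c :
    measurable_fun setT f -> (forall x, 0 <= f x)%E ->
    (forall x : R, f (x + 2 * pi) = f x) ->
  (\int[uniform_prob (lt0_2pi R)]_x f (shiftr c x) =
   \int[uniform_prob (lt0_2pi R)]_x f x)%E.
Proof.
move=> mf f0 fP; set P := 2 * pi.
wlog /andP[c0 cP] : c / 0 <= c <= P => [hwlog|].
  have P0 : 0 < P by exact: lt0_2pi.
  (* Whole periods in the shift are absorbed by the periodicity of [f]. *)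
  pose m := Num.floor (c / P).
  rewrite -(hwlog (c - m%:~R * P)).
    apply: eq_integral => x _; rewrite -[in RHS](periodicz fP m).
    by congr f; rewrite /shiftr -addrA subrK.
  have /andP[h1 h2] := floor_itv (c / P).
  rewrite subr_ge0 -ler_pdivlMr// h1/= ltW// ltrBlDl.
  by rewrite -[X in _ + X]mul1r -mulrDl -ltr_pdivrMr// -[1]/(1%:~R) -intrD.
have mfc : measurable_fun setT (fun x => f (shiftr c x)).
  exact: (measurableT_comp mf (measurable_shiftr c)).
rewrite !integral_uniform//; congr (_ * _)%E.
rewrite -!integral_itv_bndo_bndc; [|exact: measurable_funTS|exact: measurable_funTS].
rewrite -[in LHS](preimage_shiftr_co _ _ c) ge0_integral_shift// add0r.
rewrite [in LHS](@itv_bndbnd_setU _ _ _ (BLeft P))//= ?bnd_simp//; last first.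
  by rewrite lerDl.
rewrite [in RHS](@itv_bndbnd_setU _ _ _ (BLeft c))//= ?bnd_simp//.
have disj (a b d : R) : disj_set `[a, b[%classic `[b, d[%classic.
  apply/disj_setPS => x [] /=; rewrite !in_itv/= => /andP[_ xb] /andP[].
  by rewrite leNgt xb.
rewrite !ge0_integral_setU//; [|exact: measurable_funTS|exact: measurable_funTS].
rewrite addeC; congr (_ + _)%E.
rewrite -{1}[P]add0r [P + c]addrC -(ge0_integral_shift P)// preimage_shiftr_co.
by apply: eq_integral => x _; rewrite fP.
Qed.

End real_line.

(** * Translations of the torus *)

Section torus_translation.
Context {R : realType}.

Lemma measurable_row_shift n (s : 'rV[R]_n) :
  measurable_fun setT (fun x : 'rV[R]_n => x + s).
Proof.
apply/measurable_fun_matrixP => i j.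
rewrite (_ : (fun _ => _) = (fun x : 'rV[R]_n => x i j + s i j)); last first.
  by apply/funext => x; rewrite mxE.
by apply: measurable_funD => //; exact: measurable_coord.
Qed.

Lemma row_consD n (a b : R) (u v : 'rV[R]_n) :
  row_cons (a + b, u + v) = row_cons (a, u) + row_cons (b, v).
Proof. by rewrite /row_cons add_row_mx raddfD. Qed.

Lemma row_cons_split n (s : 'rV[R]_(1 + n)) :
  s = row_cons (s ord0 (lshift n ord0), rsubmx s).
Proof.
rewrite /row_cons -[LHS]hsubmxK; congr row_mx.
by rewrite [lsubmx s]mx11_scalar mxE.
Qed.

Lemma row_cons_el n (a : R) : row_cons (a, 0 : 'rV[R]_n) = a *: 'e_(lshift n ord0).
Proof.
apply/rowP => j; rewrite [RHS]mxE; case: (split_ordP j) => k ->.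
  by rewrite row_mxEl !mxE !ord1 !eqxx /= mulr1n mulr1.
by rewrite row_mxEr !mxE eqxx eq_rlshift mulr0.
Qed.

Lemma row_cons_er n (a : R) (i : 'I_n) :
  row_cons (0, a *: 'e_i) = a *: 'e_(rshift 1 i) :> 'rV[R]_(1 + n).
Proof.
apply/rowP => j; rewrite [RHS]mxE; case: (split_ordP j) => k ->.
  by rewrite row_mxEl [LHS]mxE mul0rn [X in _ * X]mxE eq_lrshift andbF mulr0.
by rewrite row_mxEr [LHS]mxE !(mxE, eqxx) /= eq_rshift.
Qed.

(** The normalized measure on the torus is its Haar measure: by Tonelli, the
    translation can be undone in one coordinate at a time, and for each
    coordinate this is the one-dimensional statement. *)
Lemma ge0_integral_torus_shift n (f : 'rV[R]_n -> \bar R) (s : 'rV[R]_n) :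
    measurable_fun setT f -> (forall x, 0 <= f x)%E -> torus_periodic f ->
  (\int[torus_measure R n]_x f (x + s)%R = \int[torus_measure R n]_x f x)%E.
Proof.
elim: n f s => [|n IHn] f s mf f0 fP.
  by apply: eq_integral => x _; rewrite [s]thinmx0 addr0.
have [s1 [s2 ->]] : exists s1 s2, s = row_cons (s1, s2).
  by do 2 eexists; exact: (@row_cons_split n s).
have mfs : measurable_fun setT (fun x : 'rV[R]_n.+1 => f (x + row_cons (s1, s2))).
  exact: (measurableT_comp mf (measurable_row_shift _)).
have mfr : measurable_fun setT (f \o @row_cons R n).
  exact: (measurableT_comp mf (@measurable_row_cons R n)).
have mfsr : measurable_fun setT
    ((fun x : 'rV[R]_n.+1 => f (x + row_cons (s1, s2))) \o @row_cons R n).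
  exact: (measurableT_comp mfs (@measurable_row_cons R n)).
rewrite /= !ge0_integral_distribution//.
rewrite [LHS]fubini_tonelli1//= [RHS]fubini_tonelli2//= /fubini_F /fubini_G/=.
have fPl x u : f (row_cons (x + 2 * pi, u)) = f (row_cons (x, u)).
  by rewrite -[u in LHS]addr0 row_consD row_cons_el fP.
have fPr x : torus_periodic (fun u => f (row_cons (x, u))).
  by move=> u i; rewrite -[x in LHS]addr0 row_consD row_cons_er fP.
transitivity (\int[uniform_prob (lt0_2pi R)]_x
    \int[torus_measure R n]_u f (row_cons (shiftr s1 x, u)))%E.
  apply: eq_integral => x _.
  under eq_integral do rewrite -row_consD.
  apply: (IHn (fun u => f (row_cons (x + s1, u)))) => //.
  apply: (measurableT_comp mfr (g := fun u => (x + s1, u))).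
  exact: measurable_fun_pair.
pose F p := f (row_cons (shiftr s1 p.1, p.2)).
have mF : measurable_fun setT F.
  apply: (measurableT_comp mfr (g := fun p => (shiftr s1 p.1, p.2))).
  apply: measurable_fun_pair => //.
  exact: (measurableT_comp (measurable_shiftr s1)).
transitivity (\int[torus_measure R n]_u
    \int[uniform_prob (lt0_2pi R)]_x F (x, u))%E.
  exact: (@fubini_tonelli _ _ _ _ _ (uniform_prob (lt0_2pi R))
    (torus_measure R n) F mF (fun=> f0 _)).
apply: eq_integral => u _.
apply: (ge0_integral_uniform_shift (f := fun x => f (row_cons (x, u)))) => //.
apply: (measurableT_comp mfr (g := fun x => (x, u))).
exact: measurable_fun_pair.
Qed.

Lemma integral_torus_shift n (f : 'rV[R]_n -> \bar R) (s : 'rV[R]_n) :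
    measurable_fun setT f -> torus_periodic f ->
  (\int[torus_measure R n]_x f (x + s)%R = \int[torus_measure R n]_x f x)%E.
Proof.
move=> mf fP; rewrite [LHS]integralE [RHS]integralE.
have fpP : torus_periodic (f^\+)%E by move=> x i; rewrite !funeposE fP.
have fnP : torus_periodic (f^\-)%E by move=> x i; rewrite !funenegE fP.
rewrite -(ge0_integral_torus_shift s (measurable_funepos mf) _ fpP)//.
rewrite -(ge0_integral_torus_shift s (measurable_funeneg mf) _ fnP)//.
by congr (_ - _)%E; apply: eq_integral => x _; rewrite ?funeposE ?funenegE.
Qed.

Lemma Rintegral_torus_shift n (f : 'rV[R]_n -> R) (s : 'rV[R]_n) :
    measurable_fun setT f -> torus_periodic f ->
  \int[torus_measure R n]_x f (x + s) = \int[torus_measure R n]_x f x.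
Proof.
move=> mf fP; congr fine.
apply: (integral_torus_shift (f := EFin \o f)); first exact/measurable_EFinP.
by move=> x i /=; rewrite fP.
Qed.

End torus_translation.

(** * Trigonometric functions as test functions *)

Section trigonometric.
Context {R : realType} {n : nat}.
Local Notation mu := (torus_measure R n).
Implicit Types (x s : 'rV[R]_n) (k : 'rV[int]_n) (p q : R * R).

Lemma pairingD k x s : pairing k (x + s) = pairing k x + pairing k s.
Proof.
by rewrite /pairing -big_split; apply: eq_bigr => i _; rewrite mxE mulrDr.
Qed.

Lemma pairing_delta k (a : R) i : pairing k (a *: 'e_i) = a * (k ord0 i)%:~R.
Proof.
rewrite /pairing (bigD1 i)//= big1 => [|j ji].
  by rewrite !mxE !eqxx addr0 mulr1 mulrC.
by rewrite !mxE eqxx (negbTE ji) !mulr0.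
Qed.

Lemma pairingDl k l x : pairing (k + l) x = pairing k x + pairing l x.
Proof.
by rewrite /pairing -big_split; apply: eq_bigr => i _; rewrite mxE intrD mulrDl.
Qed.

Lemma pairingN k x : pairing k (- x) = - pairing k x.
Proof.
by rewrite /pairing -sumrN; apply: eq_bigr => i _; rewrite mxE mulrN.
Qed.

Lemma pairing0l x : pairing 0 x = 0.
Proof. by rewrite /pairing big1// => i _; rewrite mxE mul0r. Qed.

Lemma pairingNl k x : pairing (- k) x = - pairing k x.
Proof.
by rewrite /pairing -sumrN; apply: eq_bigr => i _; rewrite mxE mulrNz mulNr.
Qed.

Lemma measurable_pairing k : measurable_fun setT (pairing k : 'rV[R]_n -> R).
Proof.
apply: measurable_sum => i; apply: measurable_funM => //.
exact: measurable_coord.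
Qed.

Lemma continuous_pairing k : continuous (pairing k : 'rV[R]_n -> R).
Proof.
rewrite /pairing; elim: (index_enum _) => [|i r IHr] x.
  rewrite (_ : (fun _ => _) = cst 0); first exact: cst_continuous.
  by apply/funext => y; rewrite big_nil.
rewrite (_ : (fun _ => _) = (fun y : 'rV[R]_n => (k ord0 i)%:~R * y ord0 i +
    \sum_(j <- r) (k ord0 j)%:~R * y ord0 j)); last first.
  by apply/funext => y; rewrite big_cons.
apply: (@continuousD _ _ _ (fun y : 'rV[R]_n => (k ord0 i)%:~R * y ord0 i));
  last exact: IHr.
by apply: continuousM; [exact: cst_continuous|exact: coord_continuous].
Qed.

(** Derivation along ['e_i] acts on [p.1 cos <k, x> + p.2 sin <k, x>] through the
    coefficients, by a quarter turn scaled by [k_i]: this is the real form of the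
    multiplication by [i k_i]. *)
Definition rot (c : R) p : R * R := (c * p.2, - (c * p.1)).

Definition dot p q : R := p.1 * q.1 + p.2 * q.2.

Definition trig k p x : R := dot p (cos (pairing k x), sin (pairing k x)).

(** The quarter turn is antisymmetric; the resulting sign is the one of
    integration by parts. *)
Lemma dot_iter_rot c m p q :
  dot (iter m (rot c) p) q = (- 1) ^+ m * dot p (iter m (rot c) q).
Proof.
elim: m p q => [|m IHm] p q; first by rewrite mul1r.
have rotN r t : dot (rot c r) t = - 1 * dot r (rot c t).
  by rewrite /dot /=; ring.
by rewrite iterSr IHm rotN exprSr mulrA.
Qed.

Lemma dot_iter_rot2 c m p :
  dot (iter m (rot c) p) (iter m (rot c) p) = c ^+ (2 * m) * dot p p.
Proof.
elim: m => [|m IHm]; first by rewrite muln0 mul1r.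
rewrite mulnS exprD -mulrA -IHm iterS /dot /=; ring.
Qed.

Lemma trig0 p x : trig 0 p x = p.1.
Proof. by rewrite /trig pairing0l cos0 sin0 /dot/= mulr1 mulr0 addr0. Qed.

Lemma trig_periodic k p : torus_periodic (trig k p).
Proof.
move=> x i; rewrite /trig pairingD pairing_delta mulrC.
rewrite (@periodicz _ _ (@cos R)) ?(@periodicz _ _ (@sin R))// => t.
  by rewrite mulr_natl sinD2pi.
by rewrite mulr_natl cosD2pi.
Qed.

Lemma measurable_trig k p : measurable_fun setT (trig k p : 'rV[R]_n -> R).
Proof.
have mc : measurable_fun setT (cos : R -> R).
  by apply: continuous_measurable_fun; exact: continuous_cos.
have ms : measurable_fun setT (sin : R -> R).
  by apply: continuous_measurable_fun; exact: continuous_sin.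
apply: measurable_funD; apply: measurable_funM => //=.
  exact: (measurableT_comp mc (measurable_pairing k)).
exact: (measurableT_comp ms (measurable_pairing k)).
Qed.

Lemma trig_continuous k p : continuous (trig k p).
Proof.
have comp (g : R -> R) : continuous g -> continuous (fun x => g (pairing k x)).
  by move=> cg x; apply: continuous_comp; [exact: continuous_pairing|exact: cg].
move=> x; apply: (@continuousD _ _ _ (fun x => p.1 * cos (pairing k x))
  (fun x => p.2 * sin (pairing k x))); apply: continuousM;
  by [exact: cst_continuous|apply: comp; exact: continuous_cos|
      apply: comp; exact: continuous_sin].
Qed.

Lemma is_derive_trig k p i x :
  is_derive x 'e_i (trig k p) (trig k (rot (k ord0 i)%:~R p) x).
Proof.
set c : R := (k ord0 i)%:~R; set t := pairing k x.
pose G (h : R) := p.1 * cos (t + h * c) + p.2 * sin (t + h * c).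
have dG : is_derive (0 : R) 1 G (trig k (rot c p) x).
  apply: is_derive_eq; rewrite /trig /dot /rot /= -/t !scaler0 !add0r mul0r addr0.
  by rewrite /GRing.scale/=; ring.
have E : (fun h => h^-1 *: ((trig k p \o shift x) (h *: 'e_i) - trig k p x)) =
         (fun h => h^-1 *: ((G \o shift 0) (h *: 1) - G 0)).
  apply/funext => h /=; rewrite /trig /dot /G /= addr0 mul0r addr0 [h *: 1]mulr1.
  by rewrite [h *: _ + x]addrC pairingD pairing_delta -/t.
have [dv eG] := dG; split; first by rewrite /derivable E.
by rewrite -eG /derive E.
Qed.

Lemma trig_test_fun k p : test_fun (trig k p).
Proof.
split; first exact: trig_periodic.
move=> m; elim: m p => [|m IHm] p; split; try exact: trig_continuous.
- by [].
- move=> i; split; first by move=> x; have [] := is_derive_trig k p i x.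
  rewrite (_ : 'D_'e_i _ = trig k (rot (k ord0 i)%:~R p)); first exact: IHm.
  by apply/funext => x; have [_] := is_derive_trig k p i x.
Qed.

(** The multi-index of the pure derivative of order [m] in the direction [i]. *)
Definition pure_index (i : 'I_n) (m : nat) : 'I_n -> nat :=
  fun j => if j == i then m else 0%N.

Lemma sum_pure_index i m : (\sum_j pure_index i m j)%N = m.
Proof. by rewrite /pure_index -big_mkcond/= big_pred1_eq. Qed.

Lemma partial_pure_trig i m k p :
  partial (pure_index i m) (trig k p) = trig k (iter m (rot (k ord0 i)%:~R) p).
Proof.
have H r q : uniq r ->
    foldr (fun j psi => iter (pure_index i m j) (fun h => 'D_'e_j h) psi)
      (trig k q) r =
    trig k (if i \in r then iter m (rot (k ord0 i)%:~R) q else q).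
  elim: r => [//|j r IHr] /= /andP[jr /IHr ->]; rewrite inE /pure_index.
  have [<-|ji] := eqVneq j i; last by [].
  rewrite (negbTE jr) /=.
  elim: m {IHr} => //= m' ->; apply/funext => x.
  by have [_] := is_derive_trig k (iter m' (rot (k ord0 j)%:~R) q) j x.
by rewrite /partial H ?enum_uniq// mem_enum.
Qed.

End trigonometric.

(** * The inner product of square-integrable functions *)

Section square_integrable.
Context d (T : measurableType d) (R : realType) (P : probability T R).
Implicit Types (f g h : T -> R).

Lemma Lnorm2E h : ('N[P]_2%:E[EFin \o h] = (\int[P]_x (h x ^+ 2)%:E) `^ (2^-1)%R)%E.
Proof.
rewrite unlock /Lnorm; congr (_ `^ _)%E; apply: eq_integral => x _.
by rewrite /= powR_mulrn// real_normK// num_real.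
Qed.

Lemma Lfun2P h : h \in Lfun P 2%:E <->
  measurable_fun setT h /\ (\int[P]_x (h x ^+ 2)%:E < +oo)%E.
Proof.
split=> [hL|[mh hoo]]; last first.
  rewrite inE; apply/andP; rewrite !inE/= /finite_norm Lnorm2E; split=> //.
  exact: poweR_lty.
move: (hL); rewrite inE => /andP[/[!inE]/= mh _]; split=> //.
exact: integrable_lty (Lfun2_integrable_sqr hL).
Qed.

Lemma Lfun2_measurable h : h \in Lfun P 2%:E -> measurable_fun setT h.
Proof. by case/Lfun2P. Qed.

Lemma Lfun2D f g : f \in Lfun P 2%:E -> g \in Lfun P 2%:E ->
  (fun x => f x + g x) \in Lfun P 2%:E.
Proof. by move=> fL gL; apply: (Lfun_addr_closed P (lee1n 2)).2. Qed.

Lemma Lfun2Z c f : f \in Lfun P 2%:E -> (fun x => c * f x) \in Lfun P 2%:E.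
Proof.
move=> fL; have := @Lfun_scale _ _ _ P f c 2 (ler1n _ 2) fL.
by rewrite (_ : c \o* f = (fun x => c * f x))//; apply/funext => x /=; rewrite mulrC.
Qed.

Lemma Lfun2_sum (I : Type) (r : seq I) (F : I -> T -> R) :
  (forall i, F i \in Lfun P 2%:E) -> (fun x => \sum_(i <- r) F i x) \in Lfun P 2%:E.
Proof.
move=> FL; elim: r => [|i r IHr].
  by under eq_fun do rewrite big_nil; exact: Lfun_cst.
by under eq_fun do rewrite big_cons; exact: Lfun2D.
Qed.

Lemma bounded_Lfun2 M f : measurable_fun setT f -> (forall x, `|f x| <= M) ->
  f \in Lfun P 2%:E.
Proof.
move=> mf fM; apply/Lfun2P; split=> //.
have : (\int[P]_x (f x ^+ 2)%:E <= \int[P]_x (cst (M ^+ 2)%:E x))%E.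
  apply: ge0_le_integral => //.
  - by move=> x _; rewrite lee_fin sqr_ge0.
  - by apply/measurable_EFinP; exact: measurable_funX.
  - move=> x _; rewrite lee_fin -[f x ^+ 2]real_normK ?num_real//.
    by rewrite ler_sqr ?nnegrE// (le_trans _ (fM x)).
move/le_lt_trans; apply.
rewrite integral_cst//= [X in (_ * X)%E](_ : _ = 1%E) ?mule1 ?ltry//.
exact: probability_setT.
Qed.

(** On square-integrable functions, the integrals below are finite, so that the
    calculus of the [L^2] inner product takes place in [R]. *)
Definition inner f g : R := \int[P]_x (f x * g x).

Lemma integrable_mul2 f g : f \in Lfun P 2%:E -> g \in Lfun P 2%:E ->
  P.-integrable setT (EFin \o (fun x => f x * g x)).
Proof. by move=> fL gL; apply/Lfun1_integrable; exact: Lfun2_mul_Lfun1. Qed.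

Lemma innerC f g : inner f g = inner g f.
Proof. by apply: eq_Rintegral => x _; rewrite mulrC. Qed.

Lemma innerDr f g h : f \in Lfun P 2%:E -> g \in Lfun P 2%:E ->
  h \in Lfun P 2%:E -> inner f (fun x => g x + h x) = inner f g + inner f h.
Proof.
move=> fL gL hL; rewrite /inner -RintegralD//; try exact: integrable_mul2.
by apply: eq_Rintegral => x _; rewrite mulrDr.
Qed.

Lemma innerZr c f g : f \in Lfun P 2%:E -> g \in Lfun P 2%:E ->
  inner f (fun x => c * g x) = c * inner f g.
Proof.
move=> fL gL; rewrite /inner -RintegralZl//; last exact: integrable_mul2.
by apply: eq_Rintegral => x _; rewrite mulrCA.
Qed.

Lemma inner_sumr (I : Type) (r : seq I) (F : I -> T -> R) f :
  f \in Lfun P 2%:E -> (forall i, F i \in Lfun P 2%:E) ->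
  inner f (fun x => \sum_(i <- r) F i x) = \sum_(i <- r) inner f (F i).
Proof.
move=> fL FL; elim: r => [|i r IHr].
  rewrite big_nil /inner -[RHS](@Rintegral_set0 _ _ _ P (fun=> 0)) /Rintegral.
  rewrite integral_set0 integral0_eq// => x _.
  by rewrite big_nil mulr0.
rewrite big_cons -IHr -innerDr//; last exact: Lfun2_sum.
by apply: eq_Rintegral => x _; rewrite big_cons.
Qed.

Lemma inner_ge0 f : 0 <= inner f f.
Proof. by apply: Rintegral_ge0 => x _; rewrite -expr2 sqr_ge0. Qed.

End square_integrable.

(** * Real Fourier coefficients and Bessel's inequality *)

Section fourier.
Context {R : realType} {n : nat}.
Local Notation mu := (torus_measure R n).
Implicit Types (h : 'rV[R]_n -> R) (x s : 'rV[R]_n) (k l : 'rV[int]_n) (p q : R * R).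

(** For real [h], the complex coefficient of frequency [k] is [C - i S], where
    [(C, S)] is this pair. *)
Definition real_coef h k : R * R :=
  (inner mu h (trig k (1, 0)), inner mu h (trig k (0, 1))).

Lemma Lfun2_trig k p : trig k p \in Lfun mu 2%:E.
Proof.
apply: (@bounded_Lfun2 _ _ _ _ (`|p.1| + `|p.2|)); first exact: measurable_trig.
move=> x; rewrite (le_trans (ler_normD _ _))//= !normrM lerD//.
  by rewrite ler_piMr// ler_norml cos_geN1 cos_le1.
by rewrite ler_piMr// ler_norml sin_geN1 sin_le1.
Qed.

Lemma inner_trig h k p : h \in Lfun mu 2%:E ->
  inner mu h (trig k p) = dot p (real_coef h k).
Proof.
move=> hL; rewrite /dot /real_coef /= -!innerZr ?Lfun2_trig// -innerDr//;
  try by apply: Lfun2Z; exact: Lfun2_trig.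
by apply: eq_Rintegral => x _; rewrite /trig /dot /=; ring.
Qed.

Lemma trig_shift k p x s : trig k p (x + s) =
  trig k (dot p (cos (pairing k s), sin (pairing k s)),
          dot p (- sin (pairing k s), cos (pairing k s))) x.
Proof. by rewrite /trig pairingD cosD sinD /dot /=; ring. Qed.

(** A nontrivial character changes sign under some translation, hence its integral
    equals its own opposite. *)
Lemma Rintegral_trig k p :
  \int[mu]_x trig k p x = if k == 0 then p.1 else 0.
Proof.
have [->|k0] := eqVneq k 0.
  rewrite (_ : (fun x => _) = cst p.1); last by apply/funext => x; exact: trig0.
  rewrite Rintegral_cst// [X in fine X](_ : _ = 1%E) ?mulr1//.
  exact: probability_setT.
have [i ki] : exists i, k ord0 i != 0.
  by apply/rV0Pn.
have kiR : (k ord0 i)%:~R != 0 :> R by rewrite intr_eq0.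
pose s := (pi / (k ord0 i)%:~R) *: 'e_i : 'rV[R]_n.
have ks : pairing k s = pi by rewrite pairing_delta divfK.
have := @Rintegral_torus_shift R n (trig k p) s (measurable_trig k p)
  (trig_periodic k p).
rewrite (_ : (fun x => trig k p (x + s)) = (fun x => -1 * trig k p x)); last first.
  apply/funext => x; rewrite trig_shift ks cospi sinpi /trig /dot/=; ring.
rewrite RintegralZl//; last first.
  by apply/Lfun1_integrable/Lfun_subset12; [exact: fin_num_measure|exact: Lfun2_trig].
by rewrite mulN1r => /eqP; rewrite eq_sym -subr_eq0 opprK -mulr2n mulrn_eq0/= => /eqP.
Qed.

(** Product-to-sum formulas. The real trigonometric functions of frequencies [k] and
    [- k] span the same space, whence the second term. *)
Lemma inner_trig_trig k l p q : inner mu (trig k p) (trig l q) =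
  2^-1 * ((if k == l then dot p q else 0) +
          (if - k == l then dot p (q.1, - q.2) else 0)).
Proof.
pose a : R * R := (dot p q, p.2 * q.1 - p.1 * q.2).
pose b : R * R := (dot p (q.1, - q.2), p.1 * q.2 + p.2 * q.1).
have -> : inner mu (trig k p) (trig l q) = inner mu (trig 0 (1, 0))
    (fun x => 2^-1 * (trig (k - l) a x + trig (k + l) b x)).
  apply: eq_Rintegral => x _; rewrite trig0 /trig !pairingDl pairingNl.
  by rewrite cosB sinB cosD sinD /a /b /dot/=; field.
have tL (m : 'rV[int]_n) c := Lfun2_trig m c.
rewrite innerZr//; last exact: Lfun2D.
rewrite innerDr// ![inner mu (trig 0 _) _]innerC; congr (_ * (_ + _)).
  rewrite -[in RHS]subr_eq0 -(Rintegral_trig (k - l) a).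
  by apply: eq_Rintegral => x _; rewrite trig0 mulr1.
rewrite -[in RHS]subr_eq0 -opprD oppr_eq0 -(Rintegral_trig (k + l) b).
by apply: eq_Rintegral => x _; rewrite trig0 mulr1.
Qed.

Lemma real_coefN h k : h \in Lfun mu 2%:E ->
  real_coef h (- k) = ((real_coef h k).1, - (real_coef h k).2).
Proof.
move=> hL; rewrite /real_coef /=; congr (_, _).
  by apply: eq_Rintegral => x _; rewrite /trig /dot/= pairingNl cosN !mul0r.
rewrite -[RHS]mulN1r -innerZr ?Lfun2_trig//.
by apply: eq_Rintegral => x _; rewrite /trig /dot/= pairingNl sinN; ring.
Qed.

Lemma dot_ge0 p : 0 <= dot p p.
Proof. by rewrite /dot -!expr2 addr_ge0 ?sqr_ge0. Qed.

(** The square of [h - S] has a nonnegative integral, where [S] is the sum of the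
    real Fourier terms [c.1 cos <k, x> + c.2 sin <k, x>] of [h] for [k] in [F]. A
    frequency [k] and its opposite have the same term: together they give the
    projection of [h] on their common plane, while one alone gives half of it for
    [k <> 0]. In both cases [inner S S <= inner h S], which is all that the
    argument needs. *)
Lemma bessel h (F : seq 'rV[int]_n) : h \in Lfun mu 2%:E -> uniq F ->
  \sum_(k <- F) dot (real_coef h k) (real_coef h k) <= inner mu h h.
Proof.
move=> hL uF; set B := \sum_(k <- F) _.
pose c k := real_coef h k.
pose S x := \sum_(k <- F) trig k (c k) x.
have tL k := Lfun2_trig k (c k).
have SL : S \in Lfun mu 2%:E by exact: Lfun2_sum.
have hS : inner mu h S = B.
  by rewrite inner_sumr//; apply: eq_bigr => k _; rewrite inner_trig.
have SS : inner mu S S <= B.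
  rewrite inner_sumr// ler_sum// => k _.
  rewrite innerC inner_sumr//.
  under eq_bigr do rewrite inner_trig_trig.
  have pick k' (E : 'rV[int]_n -> R) : 0 <= E k' ->
      \sum_(l <- F) (if k' == l then E l else 0) <= E k'.
    move=> E0; rewrite -big_mkcond/=.
    have [kF|kF] := boolP (k' \in F).
      rewrite (big_rem k')//= eqxx big_seq_cond big1 ?addr0// => l.
      rewrite mem_rem_uniq// inE => /andP[/andP[/negP lk _] /eqP kl].
      by case: lk; rewrite kl.
    rewrite big_seq_cond big1// => l /andP[lF /eqP kl].
    by rewrite kl lF in kF.
  (* Only [l = k] and [l = - k] contribute to the inner sum. *)
  rewrite -mulr_sumr big_split /= ler_pdivrMl// mulr2n mulrDl mul1r.
  rewrite lerD//; first exact/pick/dot_ge0.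
  have E : dot (c k) ((c (- k)).1, - (c (- k)).2) = dot (c k) (c k).
    by rewrite /c real_coefN//; case: (real_coef h k) => u v; rewrite /= opprK.
  rewrite -[leRHS]E; apply: (pick (- k) (fun l => dot (c k) ((c l).1, - (c l).2))).
  by rewrite E dot_ge0.
have := inner_ge0 mu (fun x => h x + -1 * S x).
have NSL := Lfun2Z (-1) SL.
rewrite innerDr//; last exact: Lfun2D.
rewrite innerZr//; last exact: Lfun2D.
rewrite ![inner mu (fun x => h x + _) _]innerC !innerDr// !innerZr//.
rewrite [inner mu S h]innerC hS; lra.
Qed.

Definition second_difference h s : 'rV[R]_n -> R :=
  fun y => h (y + s) + h (y - s) - 2 * h y.

Lemma Lfun2_shift h s : torus_periodic h -> h \in Lfun mu 2%:E ->
  (fun y => h (y + s)) \in Lfun mu 2%:E.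
Proof.
move=> hP /Lfun2P[mh hoo]; apply/Lfun2P; split.
  exact: (measurableT_comp mh (measurable_row_shift s)).
rewrite (@integral_torus_shift _ _ (fun x => (h x ^+ 2)%:E) s)//.
  by apply/measurable_EFinP; exact: measurable_funX.
by move=> x i; rewrite hP.
Qed.

Lemma Lfun2_second_difference h s : torus_periodic h -> h \in Lfun mu 2%:E ->
  second_difference h s \in Lfun mu 2%:E.
Proof.
move=> hP hL; rewrite (_ : second_difference h s =
    fun y => (h (y + s) + h (y - s)) + - 2 * h y); last first.
  by apply/funext => y; rewrite /second_difference mulNr.
by apply: Lfun2D; [apply: Lfun2D; exact: Lfun2_shift|exact: Lfun2Z].
Qed.

Lemma inner_shift_trig h s k p : torus_periodic h -> h \in Lfun mu 2%:E ->
  inner mu (fun y => h (y + s)) (trig k p) = inner mu h (fun y => trig k p (y - s)).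
Proof.
move=> hP hL.
rewrite -[RHS](@Rintegral_torus_shift _ _ _ s); last 2 first.
- apply: measurable_funM; first exact: Lfun2_measurable hL.
  exact: (measurableT_comp (measurable_trig k p) (measurable_row_shift _)).
- by move=> x i; rewrite hP addrAC trig_periodic.
by apply: eq_Rintegral => x _; rewrite addrK.
Qed.

(** Translation by [s] multiplies the Fourier coefficient by [e^{i <k, s>}], and
    [e^{i u} + e^{- i u} - 2 = 2 cos u - 2]. *)
Lemma inner_second_difference h s k p : torus_periodic h -> h \in Lfun mu 2%:E ->
  inner mu (second_difference h s) (trig k p) =
  (2 * cos (pairing k s) - 2) * inner mu h (trig k p).
Proof.
move=> hP hL; have tL := Lfun2_trig k.
rewrite (_ : second_difference h s =
    fun y => (h (y + s) + h (y - s)) + - 2 * h y); last first.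
  by apply/funext => y; rewrite /second_difference mulNr.
rewrite innerC innerDr//;
  [|exact: Lfun2D (Lfun2_shift _ _ _) (Lfun2_shift _ _ _)|exact: Lfun2Z].
rewrite innerDr//; [|exact: Lfun2_shift|exact: Lfun2_shift].
rewrite innerZr// ![inner mu (trig k p) _]innerC !inner_shift_trig//.
under [X in inner mu h X + _ + _]eq_fun do rewrite trig_shift.
under [X in _ + inner mu h X + _]eq_fun do rewrite trig_shift.
by rewrite !inner_trig// opprK pairingN cosN sinN /dot/=; ring.
Qed.

End fourier.

(** * Vector-valued functions, weak derivatives and moduli *)

Section vector_valued.
Context {R : realType} {n : nat}.
Local Notation mu := (torus_measure R n).
Implicit Types (f g : 'rV[R]_n -> 'rV[R]_n) (s : 'rV[R]_n) (k : 'rV[int]_n).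

Definition component f (j : 'I_n) : 'rV[R]_n -> R := fun x => f x ord0 j.

Lemma component_periodic f j : torus_L2 f -> torus_periodic (component f j).
Proof. by move=> [fP _] x i; rewrite /component fP. Qed.

Lemma component_Lfun2 f j : torus_L2 f -> component f j \in Lfun mu 2%:E.
Proof. by move=> [_]; exact. Qed.

Lemma sqr_l2normc_fourier f k : torus_L2 f -> l2normc (fourier_coef f k) ^+ 2 =
  \sum_j dot (real_coef (component f j) k) (real_coef (component f j) k).
Proof.
move=> fL; rewrite /l2normc sqr_sqrtr; last by apply: sumr_ge0 => j _; rewrite sqr_ge0.
apply: eq_bigr => j _; rewrite mxE /Cintegral /= sqr_sqrtr; last first.
  by rewrite addr_ge0 ?sqr_ge0.
rewrite /dot -!expr2 /real_coef /=; congr (_ ^+ 2 + _).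
  by apply: eq_Rintegral => x _; rewrite /= cosN /trig /dot /component/=; ring.
rewrite -[RHS]sqrrN; congr (_ ^+ 2).
rewrite -[RHS]mulN1r -innerZr ?Lfun2_trig ?component_Lfun2//.
by apply: eq_Rintegral => x _; rewrite /= sinN /trig /dot /component/=; ring.
Qed.

(** Testing the weak derivative against the trigonometric functions of frequency
    [k] turns it into the multiplication by [(i k_i)^m]. *)
Lemma fourier_weak_partial i m f g k : torus_L2 f ->
  is_weak_partial (pure_index i m) f g ->
  l2normc (fourier_coef g k) ^+ 2 =
  (k ord0 i)%:~R ^+ (2 * m) * l2normc (fourier_coef f k) ^+ 2.
Proof.
move=> fL [gL fg]; rewrite !sqr_l2normc_fourier// mulr_sumr.
apply: eq_bigr => j _; rewrite -dot_iter_rot2.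
suff -> : real_coef (component g j) k =
    iter m (rot (k ord0 i)%:~R) (real_coef (component f j) k) by [].
have E p : dot p (real_coef (component g j) k) =
    dot p (iter m (rot (k ord0 i)%:~R) (real_coef (component f j) k)).
  have := fg _ (trig_test_fun k p) j; rewrite partial_pure_trig sum_pure_index.
  rewrite -[X in X = _ -> _]/(inner mu (component f j) (trig k _)).
  rewrite -[X in _ = _ * X -> _]/(inner mu (component g j) (trig k _)).
  rewrite !inner_trig ?component_Lfun2// dot_iter_rot.
  by move/mulfI => ->//; rewrite signr_eq0.
move: (E (1, 0)) (E (0, 1)); case: (iter _ _ _) => u v; case: (real_coef _ _) => a b.
by rewrite /dot /= !mul0r !mul1r !addr0 !add0r => -> ->.
Qed.

(** Bessel's inequality for the second difference, whose Fourier coefficients are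
    those of [g] times [2 cos <k, s> - 2]. *)
Lemma bessel_modulus0 g s t (F : seq 'rV[int]_n) :
  torus_L2 g -> l1norm s <= t -> uniq F ->
  ((\sum_(k <- F) (2 * cos (pairing k s) - 2) ^+ 2 *
     l2normc (fourier_coef g k) ^+ 2)%:E <= modulus0 g t ^+ 2)%E.
Proof.
move=> gL st uF; set N := 'N[mu]_2%:E[EFin \o (l2norm \o second_diff g s)]%E.
have N_le : (N <= modulus0 g t)%E by apply: ereal_sup_ubound; exists s.
apply: (@le_trans _ _ (N ^+ 2)%E); last first.
  by rewrite lee_sqr ?Lnorm_ge0// (le_trans _ N_le)// Lnorm_ge0.
have hP j := @component_periodic g j gL; have hL j := @component_Lfun2 g j gL.
have dL j := Lfun2_second_difference s (hP j) (hL j).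
pose d j := second_difference (component g j) s.
have -> : (N ^+ 2 = (\sum_j inner mu (d j) (d j))%:E)%E.
  rewrite /N Lnorm2E poweR12_sqrt ?sqr_sqrte;
    try by apply: integral_ge0 => x _; rewrite lee_fin sqr_ge0.
  transitivity (\int[mu]_x (\sum_j (d j x ^+ 2)%:E))%E.
    apply: eq_integral => x _; rewrite /= /l2norm sqr_sqrtr; last first.
      by apply: sumr_ge0 => j _; rewrite sqr_ge0.
    rewrite sumEFin; congr EFin; apply: eq_bigr => j _.
    by rewrite /d /second_difference /component /second_diff !mxE.
  rewrite ge0_integral_sum//; last 2 first.
  - move=> j; apply/measurable_EFinP; apply: measurable_funX.
    exact: Lfun2_measurable (dL j).
  - by move=> j x _; rewrite lee_fin sqr_ge0.
  rewrite -sumEFin; apply: eq_bigr => j _; rewrite /inner /Rintegral fineK.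
    by apply: eq_integral => x _; rewrite expr2.
  by apply: integrable_fin_num => //; exact: (integrable_mul2 (dL j) (dL j)).
rewrite lee_fin.
apply: (@le_trans _ _ (\sum_j \sum_(k <- F)
    dot (real_coef (d j) k) (real_coef (d j) k))); last first.
  by apply: ler_sum => j _; exact: (bessel (dL j)).
rewrite exchange_big/= le_eqVlt; apply/orP; left; apply/eqP; apply: eq_bigr => k _.
rewrite sqr_l2normc_fourier// mulr_sumr; apply: eq_bigr => j _.
by rewrite /real_coef !inner_second_difference// /dot/=; ring.
Qed.

End vector_valued.

(** * Frequencies in an annulus *)

Section frequency_annulus.
Context {R : realType} {n : nat}.
Implicit Types k : 'rV[int]_n.

Lemma l1normz_max k : (0 < n)%N ->
  exists i, (l1normz k <= n * `|k ord0 i|)%N.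
Proof.
move=> n0; pose i := [arg max_(j > Ordinal n0) `|k ord0 j|%N].
exists i; rewrite /i; case: arg_maxnP => // j _ jmax.
rewrite -[X in (X * _)%N]card_ord -sum_nat_const.
by apply: leq_sum => l _; exact: jmax.
Qed.

Lemma le_l1normz k i : (`|k ord0 i| <= l1normz k)%N.
Proof. by rewrite /l1normz (bigD1 i)//= leq_addr. Qed.

(** The angles [|k_i| t] that matter are at least [1 / (n b^2)]; this is the
    resulting lower bound for the square of [2 cos u - 2]. *)
Definition gap (b : nat) : R := (2 - 2 * cos (n%:R * b%:R ^+ 2)^-1) ^+ 2.

Lemma angle_le1 b : (2 <= b)%N -> (0 < n)%N ->
  0 < (n%:R * b%:R ^+ 2 : R)^-1 <= 1.
Proof.
move=> b2 n0; have b1 : 1 <= b%:R :> R by rewrite ler1n (leq_trans _ b2).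
have n1 : 1 <= n%:R :> R by rewrite ler1n.
rewrite invr_gt0 mulr_gt0 ?exprn_gt0 ?(lt_le_trans ltr01)//=.
by rewrite invf_le1 ?mulr_gt0 ?exprn_gt0 ?(lt_le_trans ltr01)// mulr_ege1// exprn_ege1.
Qed.

Lemma cos_angle_lt1 b : (2 <= b)%N -> (0 < n)%N ->
  cos (n%:R * b%:R ^+ 2 : R)^-1 < 1.
Proof.
move=> b2 n0; have /andP[d0 d1] := angle_le1 b2 n0.
have pi1 : 1 <= pi :> R by rewrite (le_trans _ (pi_ge2 R))// ler1n.
rewrite -[ltRHS]cos0 ltr_cos ?d0// in_itv/= ?lexx ?pi_ge0//.
by rewrite (ltW d0) (le_trans d1).
Qed.

Lemma gap_gt0 b : (2 <= b)%N -> (0 < n)%N -> 0 < gap b.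
Proof.
move=> b2 n0; rewrite exprn_gt0// subr_gt0 -[ltRHS]mulr1 ltr_pM2l//.
exact: cos_angle_lt1.
Qed.

(** Some coordinate carries at least the fraction [1 / n] of [|k|]. In the annulus,
    [|k|] is between [b^(nu-1)] and [b^nu], so for this coordinate the angle
    [|k_i| t] lies between [1 / (n b^2)] and [1], where the cosine decreases. *)
Lemma annulus_gap b nu t k : (2 <= b)%N -> (0 < n)%N ->
  k \in annulus (R := R) b nu -> b%:R ^- nu.+1 < t < b%:R ^- nu ->
  exists i, (l1normz k <= n * `|k ord0 i|)%N /\
    gap b <= (2 * cos (pairing k (t *: 'e_i)) - 2) ^+ 2.
Proof.
move=> b2 n0; rewrite inE /annulus/= => /andP[kl ku] /andP[tl tu].
have b0 : 0 < b%:R :> R by rewrite ltr0n (leq_trans _ b2).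
have bn0 m : 0 < b%:R ^+ m :> R by rewrite exprn_gt0.
have nR : 0 < n%:R :> R by rewrite ltr0n.
have t0 : 0 < t by rewrite (lt_trans _ tl)// invr_gt0.
have [i ki] := l1normz_max k n0; exists i; split=> //.
rewrite pairing_delta /gap.
set z : R := (k ord0 i)%:~R; set delta := (_ * _)^-1.
have zE : `|z| = `|k ord0 i|%N%:R by rewrite /z -intr_norm natr_absz.
have z1 : t * `|z| <= 1.
  rewrite -(@mulVf _ (b%:R ^+ nu)) ?gt_eqF//.
  apply: ler_pM; [exact: ltW|exact: normr_ge0|exact: ltW|].
  by apply: le_trans ku; rewrite zE ler_nat le_l1normz.
have zd : delta <= t * `|z|.
  have kz : (l1normz k)%:R <= n%:R * `|z| by rewrite zE -natrM ler_nat.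
  have -> : delta = b%:R ^- nu.+1 * ((b%:R ^ (nu%:Z - 1)) / n%:R).
    rewrite expfzDr ?gt_eqF// exprN1 -exprnP /delta [_ ^+ nu.+1]exprS; field.
    by rewrite !gt_eqF ?exprn_gt0.
  apply: ler_pM => //; first exact: ltW.
  by rewrite ler_pdivrMr// mulrC (le_trans (ltW kl)).
have /andP[d0 d1] := angle_le1 b2 n0.
have pi1 : 1 <= pi :> R by rewrite (le_trans _ (pi_ge2 R))// ler1n.
have cz : cos (t * z) <= cos delta.
  rewrite -cos_norm normrM (gtr0_norm t0) leNgt ltr_cos -?leNgt//.
    by rewrite in_itv/= (le_trans z1)// andbT mulr_ge0 ?normr_ge0// ltW.
  by rewrite in_itv/= (ltW d0) (le_trans d1).
have cd := cos_angle_lt1 b2 n0.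
rewrite -[leRHS]sqrrN opprB ler_sqr ?nnegrE; [|lra|lra].
by rewrite lerD2l lerN2 ler_pM2l.
Qed.

End frequency_annulus.

(** * The estimate on one annulus *)

Section main_estimate.
Context {R : realType} {n : nat}.
Local Notation mu := (torus_measure R n).
Implicit Types (f : 'rV[R]_n -> 'rV[R]_n) (k : 'rV[int]_n).

Lemma sobolev_pure_partial m f i : sobolev m f ->
  is_weak_partial (pure_index i m) f (weak_partial (pure_index i m) f).
Proof.
move=> [_ H]; have [g fg] := H (pure_index i m) (eq_leq (sum_pure_index i m)).
apply: (xgetPex (cst 0) (P := [set g | is_weak_partial (pure_index i m) f g])).
by exists g.
Qed.

(** The square of [modulus], before the square root is taken. *)
Definition modulus_sum m f (t : R) : \bar R :=
  (\sum_(a : {ffun 'I_n -> 'I_m.+1} | (\sum_i a i == m)%N)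
      modulus0 (weak_partial (fun i => a i) f) t ^+ 2)%E.

Lemma modulus_sum_ge0 m f t : (0 <= modulus_sum m f t)%E.
Proof. by apply: sume_ge0 => a _; exact: sqre_ge0. Qed.

Lemma pure_modulus0_le m f i t :
  (modulus0 (weak_partial (pure_index i m) f) t ^+ 2 <= modulus_sum m f t)%E.
Proof.
pose a : {ffun 'I_n -> 'I_m.+1} := [ffun j => inord (pure_index i m j)].
have aE : (fun j => a j : nat) = pure_index i m.
  by apply/funext => j; rewrite ffunE inordK// /pure_index; case: ifP.
rewrite /modulus_sum (bigD1 a)/=; last first.
  by rewrite (eq_bigr (pure_index i m)) ?sum_pure_index// => j _; rewrite -aE.
by rewrite aE leeDl// sume_ge0// => c _; exact: sqre_ge0.
Qed.

(** Each frequency [k] of the annulus is controlled by the pure derivative in the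
    direction [i] of its largest coordinate, where [(n |k_i|)^m >= |k|^m], tested
    with the second difference of step [t] in the same direction. As [i] depends on
    [k], all directions are added up. *)
Lemma annulus_sum_le_modulus b m nu f t (F : seq 'rV[int]_n) :
  (2 <= b)%N -> (0 < n)%N -> sobolev m f ->
  b%:R ^- nu.+1 < t < b%:R ^- nu -> uniq F ->
  (forall k, k \in F -> k \in annulus (R := R) b nu) ->
  ((\sum_(k <- F) l2normc (fourier_coef f k) ^+ 2 * (l1normz k)%:R ^+ (2 * m))%:E <=
   (n%:R ^+ (2 * m).+1 / gap (R := R) (n := n) b)%:E * modulus_sum m f t)%E.
Proof.
move=> b2 n0 fS tI uF FA; have gb := @gap_gt0 R n b b2 n0.
have t0 : 0 < t.
  have /andP[tl _] := tI; rewrite (lt_trans _ tl)// invr_gt0 exprn_gt0// ltr0n.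
  exact: leq_trans b2.
have fL : torus_L2 f by case: fS.
pose g i := weak_partial (pure_index i m) f.
have fg i := sobolev_pure_partial i fS.
have gL i : torus_L2 (g i) by case: (fg i).
pose D k := l2normc (fourier_coef f k) ^+ 2.
pose c i k := (2 * cos (pairing k (t *: 'e_i : 'rV[R]_n)) - 2) ^+ 2.
pose B i := \sum_(k <- F) c i k * l2normc (fourier_coef (g i) k) ^+ 2.
have BS i : ((B i)%:E <= modulus_sum m f t)%E.
  apply: le_trans (pure_modulus0_le m f i t).
  apply: bessel_modulus0 => //; rewrite /l1norm (bigD1 i)//= big1 => [|j ji].
    by rewrite !mxE !eqxx mulr1 addr0 gtr0_norm.
  by rewrite !mxE eqxx (negbTE ji) mulr0 normr0.
have pointwise k : k \in F ->
    D k * (l1normz k)%:R ^+ (2 * m) <= n%:R ^+ (2 * m) / gap (R := R) (n := n) b *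
      \sum_i c i k * l2normc (fourier_coef (g i) k) ^+ 2.
  move=> kF; have [i [ki ci]] := annulus_gap b2 n0 (FA k kF) tI.
  have kiE : (k ord0 i)%:~R ^+ (2 * m) = (`|k ord0 i|%N%:R : R) ^+ (2 * m).
    by rewrite !exprM natr_absz intr_norm real_normK// num_real.
  have D0 : 0 <= D k by exact: sqr_ge0.
  (* Only the direction [i] is kept. *)
  rewrite (bigD1 i)//= mulrDr; apply: ler_wpDr.
    rewrite mulr_ge0 ?divr_ge0 ?exprn_ge0 ?(ltW gb)//.
    by apply: sumr_ge0 => j _; rewrite mulr_ge0 ?sqr_ge0.
  rewrite (fourier_weak_partial k fL (fg i)) kiE -/(D k).
  rewrite [leRHS](_ : _ = c i k * ((n%:R * `|k ord0 i|%N%:R) ^+ (2 * m) * D k) /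
    gap (R := R) (n := n) b); last by rewrite exprMn; ring.
  rewrite ler_pdivlMr//.
  rewrite [leLHS]mulrC; apply: ler_pM => //; first exact: ltW.
    by rewrite mulr_ge0// exprn_ge0.
  by rewrite mulrC ler_wpM2r// lerXn2r ?nnegrE ?mulr_ge0// -natrM ler_nat.
apply: (@le_trans _ _ ((n%:R ^+ (2 * m) / gap (R := R) (n := n) b * \sum_i B i)%:E)).
  rewrite lee_fin exchange_big mulr_sumr big_seq_cond [leRHS]big_seq_cond.
  by apply: ler_sum => k /andP[kF _]; exact: pointwise.
rewrite exprSr [(_ * n%:R / _)%R]mulrAC !EFinM -[leRHS]muleA.
apply: lee_wpmul2l; first by rewrite lee_fin divr_ge0 ?exprn_ge0 ?(ltW gb).
rewrite -sumEFin (@le_trans _ _ (\sum_(i < n) modulus_sum m f t)%E)//.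
  by apply: lee_sum => i _; exact: BS.
by rewrite sumr_const card_ord mule_natl.
Qed.

End main_estimate.

(** * Dini integrals and series *)

Section dini.
Context {R : realType}.
Local Open Scope ereal_scope.

(** The integral of a nonnegative function is a supremum over simple functions,
    so it is monotone even where measurability is not known. *)
Lemma ge0_le_integral_nomeas d (T : measurableType d)
    (mu : {measure set T -> \bar R}) (D : set T) (f g : T -> \bar R) :
  (forall x, D x -> 0 <= f x) -> (forall x, D x -> f x <= g x) ->
  \int[mu]_(x in D) f x <= \int[mu]_(x in D) g x.
Proof.
move=> f0 fg; rewrite !(integral_mkcond D).
have fg' x : (f \_ D) x <= (g \_ D) x by exact: lee_restrict.
have f0' x : 0 <= (f \_ D) x by exact: erestrict_ge0.
rewrite !ge0_integralTE// => [|x]; last exact: le_trans (f0' x) (fg' x).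
by apply: le_ereal_sup => _ [h hf <-]; exists h => // x; exact: le_trans (hf x) (fg' x).
Qed.

(** The open intervals from [b^-(nu+1)] to [b^-nu] are disjoint, and each has mass at
    least [1 - b^-1] for [dt / t], as [1 / t >= b^nu] there. *)
Lemma dini_series (b : nat) (w : R -> \bar R) (a : nat -> \bar R) :
    (2 <= b)%N -> (forall nu, 0 <= a nu) ->
    (forall t, 0 <= w t) ->
    (forall nu t, (b%:R ^- nu.+1 < t < b%:R ^- nu)%R -> a nu <= w t) ->
  \sum_(0 <= nu <oo) (a nu * (1 - b%:R^-1)%:E) <=
  \int[lebesgue_measure]_(t in `]0%R, 1%R[) (w t * (t^-1)%:E).
Proof.
move=> b2 a0 w0 aw.
have b0 : (0 < b%:R :> R)%R by rewrite ltr0n (leq_trans _ b2).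
have bn0 nu : (0 < b%:R ^- nu :> R)%R by rewrite invr_gt0 exprn_gt0.
have b1 : (b%:R^-1 < 1 :> R)%R by rewrite invf_lt1// ltr1n.
have bS nu : (b%:R ^- nu.+1 = b%:R ^- nu * b%:R^-1 :> R)%R by rewrite exprSr invfM.
have bmono (i j : nat) : (i <= j)%N -> (b%:R ^- j <= b%:R ^- i :> R)%R.
  by move=> ij; rewrite lef_pV2 ?posrE ?exprn_gt0// ler_weXn2l// ler1n (leq_trans _ b2).
pose I nu := `]b%:R ^- nu.+1, b%:R ^- nu[%classic : set R.
pose c nu := a nu * (b%:R ^+ nu)%:E.
have c0 nu : 0 <= c nu by rewrite mule_ge0// lee_fin exprn_ge0// ltW.
have Ilt i j t : I i t -> I j t -> (j <= i)%N.
  rewrite /I /= !in_itv/= => /andP[ti _] /andP[_ tj]; rewrite leqNgt; apply/negP => ij.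
  by have := lt_trans ti tj; rewrite ltNge bmono.
have int_c nu : \int[lebesgue_measure]_(t in `]0%R, 1%R[) (cst (c nu) \_ (I nu)) t =
    a nu * (1 - b%:R^-1)%:E.
  rewrite -integral_mkcondr setIidr; last first.
    move=> t; rewrite /I /= !in_itv/= => /andP[t1 t2].
    rewrite (lt_trans _ t1)//= (lt_le_trans t2)//.
    by have := bmono 0%N nu (leq0n _); rewrite expr0 invr1.
  rewrite integral_cst; last exact: measurable_itv.
  rewrite /I /= lebesgue_measure_itv/= lte_fin bS gtr_pMr// b1.
  rewrite /c -muleA -EFinB -EFinM; congr (_ * _%:E).
  rewrite mulrBr mulrA divff ?mul1r// gt_eqF// exprn_gt0//.
apply: lime_le.
  apply: is_cvg_nneseries => nu _ _.
  by rewrite mule_ge0// lee_fin subr_ge0 ltW.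
apply: nearW => N; under eq_bigr do rewrite -int_c.
have mc nu : measurable_fun (`]0%R, 1%R[%classic : set (measurableTypeR R))
    (cst (c nu) \_ (I nu)).
  by apply/measurable_restrict => //; exact: measurable_itv.
have cr0 nu t : 0 <= (cst (c nu) \_ (I nu)) t by apply: erestrict_ge0 => ? _; exact: c0.
rewrite -ge0_integral_sum//.
apply: ge0_le_integral_nomeas; first by move=> t _; apply: sume_ge0.
move=> t; rewrite /= in_itv/= => /andP[t0 t1].
have rhs0 : 0 <= w t * (t^-1)%:E by rewrite mule_ge0// lee_fin invr_ge0 ltW.
have [[nu It]|noI] := pselect (exists nu, I nu t); last first.
  by rewrite big1// => nu _; rewrite patchE memNset// => It; apply: noI; exists nu.
rewrite (eq_bigr (fun m => if m == nu then c nu else 0)) => [|m _]; last first.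
  rewrite patchE; have [->|mnu] := eqVneq m nu; first by rewrite mem_set.
  rewrite memNset// => Im; case/negP: mnu; rewrite eqn_leq.
  by rewrite (Ilt _ _ _ It Im) (Ilt _ _ _ Im It).
rewrite -big_mkcond big_nat1_eq; case: ifP => // _.
have := It; rewrite /I /= in_itv/= => Itv.
rewrite lee_pmul ?aw// ?lee_fin ?exprn_ge0 ?(ltW b0)//.
have /andP[_ tlt] := Itv.
by rewrite -[leLHS]invrK lef_pV2 ?posrE ?bn0// ltW.
Qed.

End dini.

(** * Summation over the annuli *)

Section conclusion.
Local Open Scope ereal_scope.

Lemma L2tilde_of_Dini (R : realType) (b n tau : nat)
    (f : 'rV[R]_n -> 'rV[R]_n) : (2 <= b)%N -> (0 < n)%N ->
  sobolev tau.+1 f -> Dini (modulus tau.+1 f) -> L2tilde tau b f.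
Proof.
move=> b2 n0 fS fD; split; first by case: fS.
set a := (X in \sum_(0 <= nu <oo) X nu).
have a0 nu : 0 <= a nu by exact: poweR_ge0.
pose K : R := (n%:R ^+ (2 * tau.+1).+1 / gap (R := R) (n := n) b)%R.
have K0 : (0 < K)%R by rewrite divr_gt0 ?gap_gt0// exprn_gt0// ltr0n.
(* The terms of the series are divided by the constant, instead of multiplying the
   modulus, so that the Dini integral keeps its form. *)
pose kappa := (K `^ 2^-1)%R.
have kappa0 : (0 < kappa)%R by exact: powR_gt0.
have aw nu t : (b%:R ^- nu.+1 < t < b%:R ^- nu)%R ->
    (kappa^-1)%:E * a nu <= modulus tau.+1 f t.
  move=> tI.
  have : a nu <= kappa%:E * modulus tau.+1 f t.
    rewrite /modulus -/(modulus_sum tau.+1 f t) /kappa -poweR_EFin.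
    rewrite -poweRM ?modulus_sum_ge0 ?lee_fin ?(ltW K0)//.
    have s0 : 0 <= \esum_(k in annulus (R := R) b nu)
        (l2normc (fourier_coef f k) ^+ 2 * (l1normz k)%:R ^+ (2 * tau + 2))%:E.
      by apply: esum_ge0 => k _; rewrite lee_fin mulr_ge0 ?sqr_ge0 ?exprn_ge0.
    rewrite /a; apply: gt0_ler_poweR; rewrite ?invr_ge0 ?in_itv/= ?leey ?andbT//.
      by rewrite mule_ge0 ?modulus_sum_ge0// lee_fin ltW.
    apply: ge_ereal_sup => _ [X [finX XA] <-].
    rewrite fsbig_finite// sumEFin.
    rewrite (_ : 2 * tau + 2 = 2 * tau.+1)%N; last by rewrite mulnS addnC.
    apply: (annulus_sum_le_modulus b2 n0 fS tI) => [|k]; first exact: finmap.fset_uniq.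
    by rewrite in_fset_set// => /set_mem /XA /mem_set.
  move=> ak; rewrite -[leRHS]mul1e -(_ : kappa^-1%:E * kappa%:E = 1); last first.
    by rewrite -EFinM mulVf// gt_eqF.
  by rewrite -muleA lee_wpmul2l// lee_fin invr_ge0 ltW.
have kinv0 : (0 < kappa^-1)%R by rewrite invr_gt0.
have b1 : (0 < 1 - b%:R^-1 :> R)%R.
  by rewrite subr_gt0 invf_lt1 ?ltr1n// ltr0n (leq_trans _ b2).
have ka0 nu : 0 <= (kappa^-1)%:E * a nu by rewrite mule_ge0// lee_fin ltW.
have := le_lt_trans (dini_series b2 ka0 (fun t => poweR_ge0 _ _) aw) fD.
pose c := (kappa^-1 * (1 - b%:R^-1))%R; have c0 : (0 < c)%R by rewrite mulr_gt0.
rewrite (eq_eseriesr (f := fun nu => (kappa^-1)%:E * a nu * (1 - b%:R^-1)%:E)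
  (g := fun nu => c%:E * a nu)) => [|nu _]; last first.
  by rewrite /= muleAC -EFinM.
rewrite nneseriesZl// => h.
rewrite -[ltLHS]mul1e -(_ : c^-1%:E * c%:E = 1); last first.
  by rewrite -EFinM mulVf// gt_eqF.
by rewrite -muleA lte_mul_pinfty// lee_fin invr_ge0 ltW.
Qed.

End conclusion.

Theorem theorem1p5 (R : realType) (b n tau : nat)
    (f : 'rV[R]_n -> 'rV[R]_n) :
  (2 <= b)%N -> (2 <= n)%N -> (1 <= tau)%N -> (1 <= n - 1 <= tau)%N ->
  sobolev tau.+1 f -> Dini (modulus tau.+1 f) -> L2tilde tau b f.
Proof.
move=> b2 n2 _ _; apply: L2tilde_of_Dini => //; exact: ltnW.
Qed.
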